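(* Let $d\ge2$ be a nonsquare integer with fundamental solution $(X_1,Y_1)$ of $x^2-dy^2=1$. Let $K$ be an integer with $K>X_1$ and $K\ge64$, and let $w=(2K)^4$. Then Program SC (defined in the context), on input $d,K,w$, returns $(X_1,Y_1)$. Its packed integer $M$ has at most $3w(2K+1)K^3=O(K^8)$ binary digits, and its intermediates outside the Hamming-weight subroutine have $O(K^8)$ binary digits.
   Context: The fundamental solution is the solution of $x^2-dy^2=1$ in positive integers with $X_1$ least. All values are in $\mathbb N=\{0,1,2,\dots\}$; $u\mathbin{\dot{-}}v=\max(u-v,0)$; $u\bmod v$ is the remainder; divisors are positive. The constants implied by $O(\cdot)$ are absolute. Intermediates are all values computed while evaluating the assignments; those ''outside the Hamming-weight subroutine'' are all except the ones computed inside the call $\mathsf H(M)$ below. Subroutine $\mathsf G_{02}(Q,K,t)$ returns $(G_0,G_2)$ computed by: $u=Q\mathbin{\dot{-}}1$, $Z_Q=Q^K$, $v=ut$, $Q_+=Q+1$, $u_3=u^3$, $G_0=\lfloor Z_Q/u\rfloor$, $z=v\mathbin{\dot{-}}2$, $g_2=vz+Q_+$, $G_2=\lfloor Z_Qg_2/u_3\rfloor$. Subroutine $\mathsf H(m)$ (Hamming weight, default form): $a=2m$, $L=2^a$, $\alpha=\lfloor(L+1)^a/L^m\rfloor\bmod L$, $e=a$, $\Pi=L$, $\gamma=\alpha\Pi$, $g=\Bigl(\Bigl\lfloor\frac{2^{\gamma(\gamma+\alpha+\Pi)}}{(2^{\gamma\alpha}\mathbin{\dot{-}}1)(2^{\gamma\Pi}\mathbin{\dot{-}}1)}\Bigr\rfloor\bmod2^\gamma\Bigr)\mathbin{\dot{-}}1$,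 $u=\Pi\mathbin{\dot{-}}1$, output $\lfloor(g^e\bmod u^2)/u\rfloor$. Subroutine $\mathsf R(d,A,B)$: $V_B=d(BB)$, $c=(AA\mathbin{\dot{-}}A)\mathbin{\dot{-}}V_B$, $V_c=cc$, $D_c=V_c\mathbin{\dot{-}}V_B$; it returns the pair $\bigl(\lfloor(V_c+V_B)/D_c\rfloor,\ \lfloor(2B)c/D_c\rfloor\bigr)$. Program SC, with input $d,K,w$ (local variables of subroutines are separate): SC1. $t=K\mathbin{\dot{-}}1$, $P=2^w$, $P_-=P\mathbin{\dot{-}}1$, $q=P^3$, $q_1=q^K$, $q_2=q_1^K$, $q_3=q_2^K$, $Q_x=q_1q_2$, $Q_y=q(q_3q_3)$. SC2. $(U_0,U_2)=\mathsf G_{02}(Q_x,K,t)$, $(V_0,V_2)=\mathsf G_{02}(Q_y,K,t)$. SC3. $T_s=P_-\bigl[V_0((P+2)U_0\mathbin{\dot{-}}U_2)+U_0(dV_2)\bigr]$. SC4. $M=\lfloor T_s/(q_2\mathbin{\dot{-}}1)\rfloor$ (the packed integer). SC5. $H_M=\mathsf H(M)$. SC6. $C=2K$, $\sigma=\lfloor(KK)t/2\rfloor$, $C_+=C+1$, $W_C=C_+\sigma$, $R_C=\lfloor H_M/w\rfloor\mathbin{\dot{-}}W_C$, $A=R_C\bmod C$, $B=\lfloor R_C/C\rfloor$. SC7. Return $\mathsf R(d,A,B)$. *)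

(* Defs.v *)
From mathcomp Require Import all_boot.

Set Implicit Arguments.
Unset Strict Implicit.
Unset Printing Implicit Defensive.

(* Right-hand sides of assignments.  They are kept as syntax so that the value
   of every subexpression can be recorded.  [Monus] is truncated subtraction
   and [Quot] is the floor of the quotient. *)
Inductive binop := Add | Monus | Mul | Pow | Quot | Rem.

Inductive expr :=
| Val of nat
| Bin of binop & expr & expr.

Coercion Val : nat >-> expr.

Declare Scope expr_scope.
Delimit Scope expr_scope with expr.
Bind Scope expr_scope with expr.
Notation "a + b" := (Bin Add a b) : expr_scope.
Notation "a - b" := (Bin Monus a b) : expr_scope.
Notation "a * b" := (Bin Mul a b) : expr_scope.
Notation "a ^ b" := (Bin Pow a b) : expr_scope.
Notation "a %/ b" := (Bin Quot a b) : expr_scope.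
Notation "a %% b" := (Bin Rem a b) : expr_scope.

(* Divisors have to be positive: [None] stands for an undefined operation,
   instead of the conventions [a %/ 0 = 0] and [a %% 0 = a] of the library. *)
Definition apply_binop (o : binop) (a b : nat) : option nat :=
  match o with
  | Add => Some (a + b)
  | Monus => Some (a - b)
  | Mul => Some (a * b)
  | Pow => Some (a ^ b)
  | Quot => if b == 0 then None else Some (a %/ b)
  | Rem => if b == 0 then None else Some (a %% b)
  end.

(* A computation either fails or returns a result together with the list of
   all values computed on the way. *)
Definition comp (A : Type) : Type := option (A * seq nat).

Definition ret (A : Type) (x : A) : comp A := Some (x, [::]).

Definition bind (A B : Type) (c : comp A) (k : A -> comp B) : comp B :=
  if c is Some (x, l1) then
    if k x is Some (y, l2) then Some (y, l1 ++ l2) else None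
  else None.

(* Each operation contributes its value to the list; variables and constants,
   which are not computed, contribute nothing. *)
Fixpoint eval (e : expr) : comp nat :=
  match e with
  | Val n => ret n
  | Bin o e1 e2 =>
      bind (eval e1) (fun a => bind (eval e2) (fun b =>
        if apply_binop o a b is Some c then Some (c, [:: c]) else None))
  end.

(* The values computed inside [c] are dropped; the value it returns to its
   caller is kept. *)
Definition hide_trace (c : comp nat) : comp nat :=
  if c is Some (x, _) then Some (x, [:: x]) else None.

Notation "'let*' x := e 'in' k" := (bind (eval e%expr) (fun x => k))
  (at level 200, x name, e at level 200, k at level 200,
   format "'[v' 'let*'  x  :=  e  'in' '/' k ']'").
Notation "'call*' p := c 'in' k" := (bind c (fun r => let: p := r in k))
  (at level 200, p pattern, c at level 200, k at level 200,
   format "'[v' 'call*'  p  :=  c  'in' '/' k ']'").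

Definition G02 (Q K t : nat) : comp (nat * nat) :=
  let* u := Q - 1 in
  let* ZQ := Q ^ K in
  let* v := u * t in
  let* Qp := Q + 1 in
  let* u3 := u ^ 3 in
  let* G0 := ZQ %/ u in
  let* z := v - 2 in
  let* g2 := v * z + Qp in
  let* G2 := (ZQ * g2) %/ u3 in
  ret (G0, G2).

Definition Hw (m : nat) : comp nat :=
  let* a := 2 * m in
  let* L := 2 ^ a in
  let* alpha := (((L + 1) ^ a) %/ (L ^ m)) %% L in
  let* e := a in
  let* Pi := L in
  let* gamma := alpha * Pi in
  let* g := (((2 ^ (gamma * (gamma + alpha + Pi)))
                %/ ((2 ^ (gamma * alpha) - 1) * (2 ^ (gamma * Pi) - 1)))
             %% (2 ^ gamma)) - 1 in
  let* u := Pi - 1 in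
  let* h := ((g ^ e) %% (u ^ 2)) %/ u in
  ret h.

Definition Rec (d A B : nat) : comp (nat * nat) :=
  let* VB := d * (B * B) in
  let* c := (A * A - A) - VB in
  let* Vc := c * c in
  let* Dc := Vc - VB in
  let* x := (Vc + VB) %/ Dc in
  let* y := ((2 * B) * c) %/ Dc in
  ret (x, y).

(* The first component of the result is the packed integer [M]; the second one
   is the pair returned by the program. *)
Definition SC (d K w : nat) : comp (nat * (nat * nat)) :=
  let* t := K - 1 in
  let* P := 2 ^ w in
  let* Pm := P - 1 in
  let* q := P ^ 3 in
  let* q1 := q ^ K in
  let* q2 := q1 ^ K in
  let* q3 := q2 ^ K in
  let* Qx := q1 * q2 in
  let* Qy := q * (q3 * q3) in
  call* (U0, U2) := G02 Qx K t in
  call* (V0, V2) := G02 Qy K t in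
  let* Ts := Pm * (V0 * ((P + 2) * U0 - U2) + U0 * (d * V2)) in
  let* M := Ts %/ (q2 - 1) in
  call* HM := hide_trace (Hw M) in
  let* C := 2 * K in
  let* sigma := ((K * K) * t) %/ 2 in
  let* Cp := C + 1 in
  let* WC := Cp * sigma in
  let* RC := (HM %/ w) - WC in
  let* A := RC %% C in
  let* B := RC %/ C in
  call* XY := Rec d A B in
  ret (M, XY).

(* The number 0 has one binary digit. *)
Definition bindigits (n : nat) : nat := (trunc_log 2 n).+1.

Definition pell_solution (d x y : nat) : Prop :=
  [/\ 0 < x, 0 < y & x ^ 2 = d * y ^ 2 + 1].

Definition fundamental_solution (d X1 Y1 : nat) : Prop :=
  pell_solution d X1 Y1 /\ forall x y, pell_solution d x y -> X1 <= x.

(* Main.v *)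
Require Import Defs.
From mathcomp Require Import all_boot.
From mathcomp Require Import zify ring.

(** Write P = 2^w, q = P^3 and m_y = d y^2 + 1.  The program finds the solutions
    of x^2 = m_y with x, y < K by looking at the number of ones, here called
    the weight, of one large integer.

    The number (P - 1)(P + 1 + m_y - x^2) has weight w + v_2(m_y - x^2) if
    x^2 < m_y, weight w if x^2 > m_y, and weight 2 w if x^2 = m_y
    ([weight_pell_digit]): a solution shows up as w additional ones.  The double
    sum T_s holds these numbers as coefficients, the one of the pair (x, y) at
    q^(y + K x + K^2 (x + 2 K y)).  Dividing by q^(K^2) - 1 turns the power
    (q^(K^2))^k into the k lower powers (q^(K^2))^j, j < k ([quot_repunits]),
    so the quotient M contains x + 2 K y copies of each coefficient, in
    disjoint base-q positions because y + K x < K^2 ([packed_quotient]).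
    Hence the weight of M is w times

      (sum of x + 2 K y over all pairs) + (sum of x + 2 K y over solutions),

    plus an excess made of the valuations v_2(m_y - x^2).  The excess is less
    than w ([excess_bound]), because the sum over x < K of v_2(m_y - x^2) is
    O(K): if x0 maximises this valuation, any other term is at most
    v_2(x0^2 - x^2) = v_2(|x0 - x|) + v_2(x0 + x), and valuations over a range
    add up to the valuation of a factorial ([sum_logn_sub_squares]).

    After the division by w and the subtraction of the known first sum, what is
    left is A + 2 K B with A = X_0 + ... + X_(n-1) and B = Y_0 + ... + Y_(n-1),
    where X_k + Y_k sqrt d are the powers of the fundamental unit, that is, all
    solutions with x < K ([pell_power_complete]).  The X_k at least double at
    each step, so A < 2 K and both sums can be read off.  The telescoping
    relation (X_1 + Y_1 sqrt d - 1)(A + B sqrt d) = X_n + Y_n sqrt d - 1,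
    together with the fact that X_n + Y_n sqrt d has norm 1, gives
    (X_1 - 1)(A^2 - A - d B^2) = d Y_1 B, from which X_1 and Y_1 are
    recovered ([Rec_correct]).

    The weight subroutine rests on three facts: 'C(2m, m) has 2-adic
    valuation the weight h of m ([logn_central_bin]), a single quotient
    computes the gcd of this binomial with 2^(2m), which is 2^h
    ([gcd_quotient]), and (2^h)^(2m) = (2^(2m))^h is 1 + h u modulo u^2 for
    u = 2^(2m) - 1 ([expn_succ_mod]).

    Outside the weight subroutine every value arises by boundedly many additions,
    multiplications and divisions from numbers of at most 48 K^8 bits, of which
    q3^K = 2^(48 K^8) is the largest ([power_tower_small]). *)

(** * Binary weight *)

(** The number of ones in the binary expansion of n, in the form of Legendre's
    formula: the central binomial coefficient and the passage from n to n - 1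
    then follow from the recursion of the factorial. *)
Definition weight (n : nat) : nat := n - logn 2 n`!.

Lemma logn_factS n : logn 2 n.+1`! = logn 2 n.+1 + logn 2 n`!.
Proof. by rewrite factS lognM ?fact_gt0. Qed.

Lemma logn_fact_bit (b : bool) n : logn 2 (b + n.*2)`! = n + logn 2 n`!.
Proof.
have even_case : logn 2 (n.*2)`! = n + logn 2 n`!.
  elim: n => [|n IHn] //.
  rewrite doubleS !logn_factS IHn -doubleS -mul2n lognM //.
  rewrite (_ : logn 2 (n.*2).+1 = 0); last first.
    by apply/eqP; rewrite lognE dvdn2 /= odd_double.
  by rewrite (logn_prime 2) //=; lia.
case: b => //=; rewrite add1n logn_factS even_case.
by rewrite (_ : logn 2 (n.*2).+1 = 0) // lognE dvdn2 /= odd_double.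
Qed.

Lemma logn_fact_le n : logn 2 n`! <= n.
Proof.
elim/ltn_ind: n => n IHn; rewrite -(odd_double_half n) logn_fact_bit.
case: (posnP n) => [-> // | n_gt0].
have lt_n2 : n./2 < n by lia.
by have := IHn _ lt_n2; lia.
Qed.

Lemma weight_le n : weight n <= n.
Proof. exact: leq_subr. Qed.

Lemma weight_bit (b : bool) n : weight (b + n.*2) = b + weight n.
Proof. by rewrite /weight logn_fact_bit; have := logn_fact_le n; lia. Qed.

(** Subtracting 1 turns a final block 10...0 of v + 1 bits into 01...1; here it
    is the recursion of the factorial. *)
Lemma weight_pred n : 0 < n -> weight n + logn 2 n = (weight n.-1).+1.
Proof.
case: n => // n _; rewrite /weight /=.
by have := logn_fact_le n.+1; have := logn_fact_le n; rewrite logn_factS; lia.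
Qed.

(** Kummer's theorem for n + n: the doubling n + n has one carry for each bit
    1 of n. *)
Lemma logn_central_bin n : logn 2 'C(2 * n, n) = weight n.
Proof.
have le_n : n <= 2 * n by lia.
have := congr1 (logn 2) (bin_fact le_n).
rewrite (_ : 2 * n - n = n); last by lia.
rewrite !lognM ?muln_gt0 ?fact_gt0 ?bin_gt0 // mul2n.
by have := logn_fact_bit false n; rewrite add0n /weight => ->; lia.
Qed.

(** No carry occurs: the bits of a lie strictly below those of 2 ^ e * b. *)
Lemma weight_cat e a b :
  a < 2 ^ e -> weight (a + 2 ^ e * b) = weight a + weight b.
Proof.
elim: e a => [|e IHe] a; first by rewrite expn0 ltnS leqn0 => /eqP ->; rewrite mul1n.
rewrite expnS => lt_a.
have -> : a + 2 * 2 ^ e * b = odd a + (a./2 + 2 ^ e * b).*2.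
  by rewrite -{1}(odd_double_half a) -!mul2n; ring.
by rewrite -[in RHS](odd_double_half a) !weight_bit IHe ?addnA //; lia.
Qed.

(** Subtracting from 11...1 flips each of the e bits. *)
Lemma weight_compl e a : a < 2 ^ e -> weight (2 ^ e - 1 - a) + weight a = e.
Proof.
elim: e a => [|e IHe] a; first by rewrite expn0 ltnS leqn0 => /eqP ->.
rewrite expnS => lt_a.
have lt_a2 : a./2 < 2 ^ e by lia.
rewrite (_ : _ - 1 - a = ~~ odd a + (2 ^ e - 1 - a./2).*2); last by lia.
have := weight_bit (odd a) a./2; rewrite odd_double_half weight_bit => ->.
by have := IHe _ lt_a2; case: odd => /=; lia.
Qed.

Lemma sum_digits_lt Q n (D : nat -> nat) :
  (forall i, i < n -> D i < Q) -> \sum_(i < n) D i * Q ^ i < Q ^ n.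
Proof.
elim: n => [|n IHn] ltD; first by rewrite big_ord0.
rewrite big_ord_recr /= expnS.
have lt_low := IHn (fun i lt_i => ltD i (ltnW lt_i)).
apply: (@leq_trans ((D n).+1 * Q ^ n)); first by rewrite mulSn ltn_add2r.
by rewrite leq_mul2r ltD ?orbT.
Qed.

Lemma weight_digits e n (D : nat -> nat) :
  (forall i, i < n -> D i < 2 ^ e) ->
  weight (\sum_(i < n) D i * (2 ^ e) ^ i) = \sum_(i < n) weight (D i).
Proof.
elim: n => [|n IHn] ltD; first by rewrite !big_ord0.
have ltD' i (lt_i : i < n) := ltD i (ltnW lt_i).
rewrite !big_ord_recr /= -expnM mulnC weight_cat ?IHn //.
by rewrite expnM; apply: sum_digits_lt.
Qed.

Lemma digit_extract Q n (D : nat -> nat) m :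
  m < n -> (forall i, i < n -> D i < Q) ->
  (\sum_(i < n) D i * Q ^ i) %/ Q ^ m %% Q = D m.
Proof.
move=> lt_mn ltD; have Q_gt0 : 0 < Q by have := ltD m lt_mn; lia.
have low : \sum_(i < m) D i * Q ^ i < Q ^ m.
  by apply: sum_digits_lt => i lt_i; apply: ltD; apply: ltn_trans lt_mn.
rewrite -(big_mkord xpredT (fun i => D i * Q ^ i)).
rewrite (@big_cat_nat _ _ _ m) //=; last exact: ltnW.
rewrite big_mkord (big_ltn lt_mn) /=.
have -> : \sum_(m.+1 <= i < n) D i * Q ^ i
          = Q ^ m * (Q * \sum_(m.+1 <= i < n) D i * Q ^ (i - m.+1)).
  rewrite !big_distrr /= !big_nat; apply: eq_bigr => i /andP[lt_mi _].
  have -> : Q ^ i = Q * Q ^ m * Q ^ (i - m.+1).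
    by rewrite -expnS -expnD subnKC.
  by ring.
set S := \sum_(m.+1 <= i < n) _.
rewrite (_ : _ + _ = (D m + Q * S) * Q ^ m + \sum_(i < m) D i * Q ^ i); last first.
  by ring.
rewrite divnMDl ?expn_gt0 ?Q_gt0 // divn_small // addn0.
by rewrite addnC mulnC modnMDl modn_small ?ltD.
Qed.

(** Let P = 2 ^ w.  For s > m the base-P digits of the product, i - 1 and P - i
    with i = s - m, are bitwise complements of each other.  For s = m the product
    is P ^ 2 - 1.  For n = m - s > 0 the digits are P - 1 - n, n - 1 and 1: the
    first is the complement of n, and the weights of n and n - 1 are related by
    [weight_pred]. *)
Lemma weight_pell_digit w s m :
  s <= 2 ^ w -> m < 2 ^ w ->
  weight ((2 ^ w - 1) * (2 ^ w + 1 + m - s))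
  = w + (s == m) * w + logn 2 (m - s).
Proof.
move=> le_s lt_m; have compl a := @weight_compl w a.
have P_gt0 : 0 < 2 ^ w by rewrite expn_gt0.
case: (ltngtP s m) => [lt_sm | lt_ms | ->] /=.
- have lt_n : m - s < 2 ^ w by lia.
  have n_gt0 : 0 < m - s by rewrite subn_gt0.
  have -> : 2 ^ w + 1 + m - s = 2 ^ w + 1 + (m - s) by lia.
  move: (m - s) lt_n n_gt0 => n lt_n n_gt0.
  have -> : (2 ^ w - 1) * (2 ^ w + 1 + n)
            = (2 ^ w - 1 - n) + 2 ^ w * (n.-1 + 2 ^ w * 1).
    by move: (2 ^ w) lt_n P_gt0 => P lt_n P_gt0; case: n n_gt0 lt_n => //= n _; nia.
  rewrite !weight_cat; try lia.
  have := compl n lt_n; have := weight_pred n n_gt0.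
  by rewrite (weight_bit true 0 : weight 1 = _); rewrite /weight /=; lia.
- have -> : (2 ^ w - 1) * (2 ^ w + 1 + m - s)
            = (s - m).-1 + 2 ^ w * (2 ^ w - 1 - (s - m).-1).
    have i_gt0 : 0 < s - m by rewrite subn_gt0.
    have -> : 2 ^ w + 1 + m - s = 2 ^ w + 1 - (s - m) by lia.
    have : s - m <= 2 ^ w by lia.
    move: (s - m) i_gt0 (2 ^ w) P_gt0 => [//|i] _ P P_gt0 /= le_i; nia.
  rewrite weight_cat; last by lia.
  have lt_i : (s - m).-1 < 2 ^ w by lia.
  by have := compl _ lt_i; rewrite (_ : m - s = 0) ?logn0; lia.
have -> : (2 ^ w - 1) * (2 ^ w + 1 + m - m)
          = (2 ^ w - 1) + 2 ^ w * (2 ^ w - 1) by rewrite addnK; nia.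
rewrite weight_cat ?subnn ?logn0; last by lia.
have := compl 0 P_gt0; rewrite subn0 (_ : weight 0 = 0) //; lia.
Qed.

(** * Sums of 2-adic valuations *)

(** This sum and the next two are at most valuations of factorials, which are
    below their argument by Legendre's formula; terms with a truncated
    difference vanish because [logn 2 0 = 0]. *)
Lemma sum_logn_above K a : \sum_(x < K) logn 2 (x - a) <= K.
Proof.
have -> : \sum_(x < K) logn 2 (x - a) = logn 2 (K.-1 - a)`!.
  elim: K => [|[|K] IHK]; first by rewrite big_ord0.
    by rewrite big_ord1.
  rewrite big_ord_recr IHK /=; case: (leqP a K) => [le_aK | lt_Ka].
    by rewrite subSn // logn_factS addnC.
  have -> : K.+1 - a = 0 by lia.
  by have -> : K - a = 0 by lia.
by apply: leq_trans (logn_fact_le _) _; lia.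
Qed.

Lemma sum_logn_below K a : \sum_(x < K) logn 2 (a - x) <= a.
Proof.
have eq_sum : \sum_(x < K) logn 2 (a - x) + logn 2 (a - K)`! = logn 2 a`!.
  elim: K => [|K IHK]; first by rewrite big_ord0 subn0.
  rewrite big_ord_recr -IHK /= -addnA; congr (_ + _).
  case: (ltnP K a) => [lt_Ka | le_aK]; first by rewrite -(subnSK lt_Ka) logn_factS.
  by have [-> ->] : a - K = 0 /\ a - K.+1 = 0 by lia.
by apply: leq_trans (logn_fact_le a); rewrite -eq_sum leq_addr.
Qed.

Lemma sum_logn_add K a : \sum_(x < K) logn 2 (a + x) <= a + K.
Proof.
apply: (@leq_trans (a + K).-1); last exact: leq_pred.
apply: leq_trans (logn_fact_le _).
elim: K => [|K IHK]; first by rewrite big_ord0.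
rewrite big_ord_recr addnS /= addnC.
by case: (a + K) IHK => [|n] //= IHK; rewrite logn_factS leq_add.
Qed.

(** Let x0 maximise v_2 (m - x ^ 2).  The power of 2 in m - x ^ 2 then divides
    m - x0 ^ 2 too, hence the difference of the two, which is x0 ^ 2 - x ^ 2 up
    to sign.  So each term other than the maximal one is bounded by the
    valuation of (x0 - x) (x0 + x), and the sum of these is linear in K.  The
    maximal term itself is at most 4 K, as m <= K ^ 4. *)
Lemma sum_logn_sub_squares K m :
  m <= K ^ 4 -> \sum_(x < K) logn 2 (m - x ^ 2) <= 8 * K.
Proof.
case: (posnP K) => [-> | K_gt0 le_m]; first by rewrite big_ord0.
pose v x := logn 2 (m - x ^ 2).
case: (@arg_maxnP _ (Ordinal K_gt0) xpredT (fun x => v x)) => // x0 _ max_x0.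
have v_le x : v x <= 4 * K.
  rewrite /v; case: (posnP (m - x ^ 2)) => [-> // | n_gt0].
  rewrite -(@leq_exp2l 2) // mulnC expnM.
  apply: leq_trans (_ : K ^ 4 <= _); last by rewrite leq_exp2r // ltnW // ltn_expl.
  apply: leq_trans le_m; apply: leq_trans (leq_subr (x ^ 2) m).
  by rewrite dvdn_leq // pfactor_dvdnn.
have v_split (x : 'I_K) :
  v x <= logn 2 (x0 - x) + logn 2 (x - x0) + logn 2 (x0 + x)
         + (if x == x0 then 4 * K else 0).
  case: eqP => [-> | neq_x]; first by have := v_le x0; lia.
  rewrite addn0; case: (posnP (v x)) => [-> // | vx_gt0].
  have vx0_gt0 := leq_trans vx_gt0 (max_x0 x isT).
  have nz z : 0 < v z -> z ^ 2 < m.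
    by rewrite /v -(subn_gt0 (z ^ 2)); case: (m - z ^ 2) => [|n]; rewrite ?logn0.
  have dvd_v z : v x <= v z -> 0 < v z -> 2 ^ v x %| m - z ^ 2.
    by move=> le_v gt0; rewrite pfactor_dvdn // subn_gt0 nz.
  have := dvd_v _ (leqnn _) vx_gt0; have := dvd_v _ (max_x0 x isT) vx0_gt0.
  have := nz _ vx_gt0; have := nz _ vx0_gt0 => /=.
  case: (ltngtP x x0) => [lt_x | lt_x | /val_inj //].
  - move=> lt0 lt dvd0 dvdx.
    have -> : x - x0 = 0 by lia.
    rewrite logn0 addn0 -lognM; try lia.
    rewrite -pfactor_dvdn // -?subn_sqr; last by nia.
    rewrite (_ : x0 ^ 2 - x ^ 2 = (m - x ^ 2) - (m - x0 ^ 2)); last by lia.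
    exact: dvdn_sub.
  - move=> lt0 lt dvd0 dvdx.
    have -> : x0 - x = 0 by lia.
    rewrite logn0 add0n -lognM; try lia.
    rewrite -pfactor_dvdn // 1?[x0 + x]addnC -?subn_sqr; last by nia.
    rewrite (_ : x ^ 2 - x0 ^ 2 = (m - x0 ^ 2) - (m - x ^ 2)); last by lia.
    exact: dvdn_sub.
apply: leq_trans (leq_sum _ (fun x _ => v_split x)) _.
rewrite !big_split /= -big_mkcond big_pred1_eq.
apply: (@leq_trans (x0 + K + (x0 + K) + 4 * K)); last by have := ltn_ord x0; lia.
by rewrite leq_add2r !leq_add ?sum_logn_below ?sum_logn_above ?sum_logn_add.
Qed.

(** * Quotients by repunits and the gcd *)

(** As b ^ k - 1 = (b - 1) (1 + b + ... + b ^ (k - 1)), division by b - 1 replaces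
    b ^ k by k lower powers of b and leaves remainder 1.  It acts on each
    summand separately as long as the remainders do not add up to b - 1. *)
Lemma quot_repunits (I : Type) (r : seq I) b (a k : I -> nat) :
  \sum_(i <- r) a i < b.-1 ->
  (\sum_(i <- r) a i * b ^ k i) %/ b.-1
  = \sum_(i <- r) a i * \sum_(j < k i) b ^ j.
Proof.
move=> lt_b; have b_gt0 : 0 < b by lia.
have -> : \sum_(i <- r) a i * b ^ k i
          = (\sum_(i <- r) a i * \sum_(j < k i) b ^ j) * b.-1
            + \sum_(i <- r) a i.
  rewrite big_distrl -big_split /=; apply: eq_bigr => i _.
  rewrite -[b ^ k i]prednK ?expn_gt0 ?b_gt0 // predn_exp mulnS.
  by ring.
by rewrite divnMDl ?divn_small ?addn0 //; lia.
Qed.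

Lemma quot_geometric Q k : 2 < Q -> Q ^ k %/ Q.-1 = \sum_(j < k) Q ^ j.
Proof.
move=> Q_gt2; have := @quot_repunits _ [:: tt] Q (fun=> 1) (fun=> k).
by rewrite !big_seq1 !mul1n; apply; lia.
Qed.

(** A divides B * j exactly when A / gcd (A, B) divides j. *)
Lemma count_multiples A B :
  0 < A -> \sum_(j < A.+1) (A %| B * j) = (gcdn A B).+1.
Proof.
move=> A_gt0; have g_gt0 : 0 < gcdn A B by rewrite gcdn_gt0 A_gt0.
have [a [b [defA defB co_ab]]] : exists a b,
    [/\ A = a * gcdn A B, B = b * gcdn A B & coprime a b].
  exists (A %/ gcdn A B), (B %/ gcdn A B).
  rewrite !divnK ?dvdn_gcdl ?dvdn_gcdr //; split=> //.
  by rewrite /coprime -(eqn_pmul2r g_gt0) muln_gcdl !divnK ?dvdn_gcdl ?dvdn_gcdr ?mul1n.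
have a_gt0 : 0 < a by move: A_gt0; rewrite defA muln_gt0 => /andP[].
rewrite -(big_mkord xpredT (fun j => nat_of_bool (A %| B * j))) big_ltn //.
rewrite muln0 dvdn0 add1n; congr _.+1.
rewrite -[RHS](mulKn _ a_gt0) -defA divn_count_dvd; apply: eq_bigr => j _.
rewrite {1}defA {2}defB mulnAC dvdn_pmul2r // Gauss_dvdr //.
Qed.

(** Mazzanti's formula.  Expanding both denominators as geometric series, the
    coefficient of X ^ 0 in the quotient counts the pairs (i, j) of natural
    numbers with A i + B j = A B, and there are gcd (A, B) + 1 of them.
    Dividing by X ^ B - 1 first is convenient: as A < B, the numerator is
    X ^ A times a power of X ^ B, with X ^ A a legitimate remainder. *)
Lemma gcd_quotient X A B :
  0 < A < B -> A + 3 < X ->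
  X ^ (A * B + A + B) %/ ((X ^ A).-1 * (X ^ B).-1) %% X = (gcdn A B).+1.
Proof.
move=> /andP[A_gt0 lt_AB] ltX; have X_gt0 : 0 < X by lia.
have XA_gt0 n : 0 < X ^ n by rewrite expn_gt0 X_gt0.
have XA : X ^ A = X ^ A.-1 * X by rewrite -expnSr prednK.
have -> : X ^ (A * B + A + B) %/ ((X ^ A).-1 * (X ^ B).-1)
          = (X ^ A * (X ^ B) ^ A.+1) %/ (X ^ B).-1 %/ (X ^ A).-1.
  rewrite -divnMA [(X ^ B).-1 * _]mulnC -expnM -expnD.
  by congr (X ^ _ %/ _); ring.
have := @quot_repunits _ [:: tt] (X ^ B) (fun=> X ^ A) (fun=> A.+1).
rewrite !big_seq1 => ->; last first.
  have : X ^ A.+1 <= X ^ B by rewrite leq_exp2l //; lia.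
  by rewrite expnS; have := XA_gt0 A; nia.
have -> : X ^ A * \sum_(j < A.+1) (X ^ B) ^ j
          = \sum_(j < A.+1) X ^ (B * j %% A) * (X ^ A) ^ (B * j %/ A).+1.
  rewrite big_distrr /=; apply: eq_bigr => j _.
  rewrite -!expnM -!expnD {1}(divn_eq (B * j) A); congr (X ^ _); ring.
rewrite quot_repunits; last first.
  apply: (@leq_ltn_trans (\sum_(j < A.+1) X ^ A.-1)).
    by apply: leq_sum => j _; rewrite leq_exp2l; [have := ltn_pmod (B * j) A_gt0; lia | lia].
  rewrite sum_nat_const card_ord -(prednK A_gt0) expnS prednK //.
  by have := XA_gt0 A.-1; nia.
have term_mod (j : 'I_A.+1) :
    X ^ (B * j %% A) * (\sum_(i < (B * j %/ A).+1) (X ^ A) ^ i) %% X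
    = (A %| B * j).
  rewrite big_ord_recl expn0 -modnMmr.
  rewrite (_ : (1 + _) %% X = 1); last first.
    rewrite (eq_bigr (fun i : 'I_ _ => (X ^ A.-1 * (X ^ A) ^ i) * X)); last first.
      by move=> i _; rewrite lift0 expnS {1}XA; ring.
    by rewrite -big_distrl /= addnC modnMDl modn_small //; lia.
  rewrite muln1 /dvdn; case: (B * j %% A) => [|r]; first by rewrite modn_small //; lia.
  by rewrite expnS modnMr.
rewrite -modn_summ (eq_bigr _ (fun j _ => term_mod j)) count_multiples //.
rewrite modn_small //.
have := dvdn_leq A_gt0 (dvdn_gcdl A B); lia.
Qed.

Lemma gcdn_expn2 n e : 0 < n -> logn 2 n <= e -> gcdn n (2 ^ e) = 2 ^ logn 2 n.
Proof.
move=> n_gt0 le_e; have [//|n' co_n' def_n] := @pfactor_coprime 2 n _ n_gt0.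
have co_n : coprime n' (2 ^ (e - logn 2 n)) by rewrite coprime_sym coprimeXl.
by rewrite {1}def_n -{1}(subnKC le_e) expnD mulnC -muln_gcdr (eqP co_n) muln1.
Qed.

(** By the binomial theorem (1 + u) ^ h is 1 + h u modulo u ^ 2. *)
Lemma expn_succ_mod u h : 1 < u -> h < u -> (u.+1 ^ h %% u ^ 2) %/ u = h.
Proof.
move=> u_gt1 lt_h.
have [s ->] : exists s, u.+1 ^ h = s * u ^ 2 + (h * u + 1).
  elim: h {lt_h} => [|h [s IHh]]; first by exists 0.
  by exists (s * u.+1 + h); rewrite expnS IHh; ring.
rewrite modnMDl modn_small; last by nia.
by rewrite divnMDl ?divn_small ?addn0 //; lia.
Qed.

Lemma bin_lt_expn2 n i : 0 < n -> 'C(n, i) < 2 ^ n.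
Proof.
case: n => // n _; elim: n i => [|n IHn] [|i]; rewrite ?bin0 //.
- by case: i.
- by rewrite -{1}(expn0 2) ltn_exp2l.
- by rewrite binS expnS; have := IHn i; have := IHn i.+1; lia.
Qed.

(** * Traces of computations and the size of their values *)

(** The form in which the program is run symbolically: the computation succeeds
    with value x and each recorded value satisfies [good]. *)
Definition computes {T : Type} (good : pred nat) (c : Defs.comp T) (x : T) : Prop :=
  exists2 trace, c = Some (x, trace) & all good trace.

Lemma computes_ret {T} (good : pred nat) (x : T) : computes good (ret x) x.
Proof. by exists [::]. Qed.

Lemma computes_bind {T U} {good : pred nat} (c : Defs.comp T) (k : T -> Defs.comp U) x y :
  computes good c x -> computes good (k x) y -> computes good (bind c k) y.
Proof.
move=> [l1 -> good1] [l2 eq2 good2]; exists (l1 ++ l2); first by rewrite /= eq2.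
by rewrite all_cat good1.
Qed.

Lemma computes_let {T} {good : pred nat} {e v} v' (k : nat -> Defs.comp T) y :
  computes good (eval e) v -> v = v' -> computes good (k v') y ->
  computes good (bind (eval e) k) y.
Proof. by move=> run_e <-; apply: computes_bind. Qed.

Lemma computes_hide {good : pred nat} {c x} :
  computes predT c x -> good x -> computes good (hide_trace c) x.
Proof. by move=> [l -> _] good_x; exists [:: x]; rewrite //= good_x. Qed.

Lemma computes_op {good : pred nat} {o e1 e2 a b c} :
  computes good (eval e1) a -> computes good (eval e2) b ->
  apply_binop o a b = Some c -> good c -> computes good (eval (Bin o e1 e2)) c.
Proof.
move=> run1 run2 eq_c good_c; apply: computes_bind run1 _.
by apply: computes_bind run2 _; rewrite eq_c; exists [:: c]; rewrite //= good_c.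
Qed.

Section Operations.

Variables (good : pred nat) (e1 e2 : expr) (a b : nat).
Hypotheses (run1 : computes good (eval e1) a) (run2 : computes good (eval e2) b).

Lemma computes_add : good (a + b) -> computes good (eval (Bin Add e1 e2)) (a + b).
Proof. exact: computes_op run1 run2 _. Qed.

Lemma computes_monus :
  good (a - b) -> computes good (eval (Bin Monus e1 e2)) (a - b).
Proof. exact: computes_op run1 run2 _. Qed.

Lemma computes_mul : good (a * b) -> computes good (eval (Bin Mul e1 e2)) (a * b).
Proof. exact: computes_op run1 run2 _. Qed.

Lemma computes_pow : good (a ^ b) -> computes good (eval (Bin Pow e1 e2)) (a ^ b).
Proof. exact: computes_op run1 run2 _. Qed.

Lemma computes_quot :
  0 < b -> good (a %/ b) -> computes good (eval (Bin Quot e1 e2)) (a %/ b).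
Proof. by move=> b_gt0; apply: (computes_op run1 run2) => //=; rewrite eqn0Ngt b_gt0. Qed.

Lemma computes_rem :
  0 < b -> good (a %% b) -> computes good (eval (Bin Rem e1 e2)) (a %% b).
Proof. by move=> b_gt0; apply: (computes_op run1 run2) => //=; rewrite eqn0Ngt b_gt0. Qed.

End Operations.

(** Reduces the evaluation of an expression to the positivity of its divisors
    and to [good] for each of its subexpressions. *)
Ltac run_expr :=
  lazymatch goal with
  | |- computes _ (eval (Bin Add _ _)) _ =>
      eapply computes_add; [run_expr | run_expr | ]
  | |- computes _ (eval (Bin Monus _ _)) _ =>
      eapply computes_monus; [run_expr | run_expr | ]
  | |- computes _ (eval (Bin Mul _ _)) _ =>
      eapply computes_mul; [run_expr | run_expr | ]
  | |- computes _ (eval (Bin Pow _ _)) _ =>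
      eapply computes_pow; [run_expr | run_expr | ]
  | |- computes _ (eval (Bin Quot _ _)) _ =>
      eapply computes_quot; [run_expr | run_expr | | ]
  | |- computes _ (eval (Bin Rem _ _)) _ =>
      eapply computes_rem; [run_expr | run_expr | | ]
  | |- computes _ (eval (Val _)) _ => exact: computes_ret
  end.

(** Executes one assignment and gives its value the simpler form v. *)
Ltac step v := eapply (computes_let v); [run_expr | | ].

(** Sizes are measured in multiples of E bits.  With E = K ^ 8 the number n is
    then an explicit constant, which the tactics below compute from the shape
    of v. *)
Definition small (E n v : nat) : bool := v <= 2 ^ (n * E).

Section Small.

Variable E : nat.
Hypothesis E_gt0 : 0 < E.

Lemma small_weaken {m} n {v} : small E m v -> m <= n -> small E n v.
Proof.
move=> small_v le_mn; apply: leq_trans small_v _.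
by rewrite leq_exp2l // leq_mul2r le_mn orbT.
Qed.

Lemma small_const v : v <= 4 -> small E 2 v.
Proof.
move=> le_v; apply: leq_trans le_v _.
by rewrite (@leq_exp2l 2 2) //; lia.
Qed.

Lemma small_le m u v : small E m v -> u <= v -> small E m u.
Proof. by move=> small_v le_uv; apply: leq_trans le_uv _. Qed.

Lemma small_add m n u v :
  small E m u -> small E n v -> small E (maxn m n).+1 (u + v).
Proof.
move=> small_u small_v.
have := small_weaken (maxn m n) small_u (leq_maxl _ _).
have := small_weaken (maxn m n) small_v (leq_maxr _ _).
rewrite /small mulSn expnD; have : 2 <= 2 ^ E by rewrite -{1}(expn1 2) leq_exp2l.
by nia.
Qed.

Lemma small_mul m n u v :
  small E m u -> small E n v -> small E (m + n) (u * v).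
Proof. by move=> small_u small_v; rewrite /small mulnDl expnD leq_mul. Qed.

Lemma small_monus m u v : small E m u -> small E m (u - v).
Proof. by move/small_le; apply; apply: leq_subr. Qed.

Lemma small_quot m u v : small E m u -> small E m (u %/ v).
Proof. by move/small_le; apply; apply: leq_div. Qed.

Lemma small_rem m u v : small E m u -> small E m (u %% v).
Proof. by move/small_le; apply; apply: leq_mod. Qed.

Lemma small_pow m u k : small E m u -> small E (k * m) (u ^ k).
Proof. by move=> small_u; case: k => [|k]; rewrite ?expn0 /small ?expn_gt0 // -mulnA mulnC expnM leq_exp2r. Qed.

End Small.

Ltac size :=
  first
  [ eassumption
  | lazymatch goal with
    | |- is_true (small _ _ (_ + _)) => eapply small_add; [assumption | size | size]
    | |- is_true (small _ _ (_ - _)) => eapply small_monus; size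
    | |- is_true (small _ _ (_ * _)) => eapply small_mul; [size | size]
    | |- is_true (small _ _ (_ ^ _)) => eapply small_pow; size
    | |- is_true (small _ _ (_ %/ _)) => eapply small_quot; size
    | |- is_true (small _ _ (_ %% _)) => eapply small_rem; size
    | |- is_true (small _ _ _) => eapply small_const; [assumption | exact: isT]
    end ].

Ltac solve_size := eapply small_weaken; [size | exact: isT].

(** * The subroutines for geometric sums and for the weight *)

Lemma G02_values_small E Q K :
  0 < E -> small E 1 K -> small E 97 (Q ^ K) -> 4 < Q ->
  small E 97 (\sum_(i < K) Q ^ i) /\ small E 99 (\sum_(i < K) i ^ 2 * Q ^ i).
Proof.
move=> E_gt0 size_K size_Z Q_gt4.
have size_S : small E 97 (\sum_(i < K) Q ^ i).
  apply: (small_le _ _ _ _ size_Z).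
  by rewrite -quot_geometric ?leq_div //; lia.
split=> //; apply: (small_le _ _ _ (K ^ 2 * \sum_(i < K) Q ^ i)); first solve_size.
rewrite big_distrr; apply: leq_sum => i _ /=.
by rewrite leq_mul2r leq_exp2r // (ltnW (ltn_ord i)) orbT.
Qed.

(** With u = Q - 1 and t = K - 1, summation by parts gives
    u ^ 3 * sum_(i < K) i ^ 2 Q ^ i
    = Q ^ K ((u t) ^ 2 - 2 u t + Q + 1) - Q (Q + 1), and Q (Q + 1) < u ^ 3 makes
    the last term disappear in the quotient. *)
Lemma G02_correct E Q K :
  0 < K -> 4 < Q -> 0 < E -> small E 1 K -> small E 5 Q -> small E 97 (Q ^ K) ->
  computes (small E 500) (G02 Q K (K - 1))
    (\sum_(i < K) Q ^ i, \sum_(i < K) i ^ 2 * Q ^ i).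
Proof.
move=> K_gt0 Q_gt4 E_gt0 size_K size_Q size_Z; rewrite /G02.
have size_t : small E 1 (K - 1) by solve_size.
step (Q - 1) => //; try solve_size.
step (Q ^ K) => //; try solve_size.
step ((Q - 1) * (K - 1)) => //; try solve_size.
step (Q + 1) => //; try solve_size.
step ((Q - 1) ^ 3) => //; try solve_size.
step (\sum_(i < K) Q ^ i) => //; try solve_size.
- by lia.
- by rewrite subn1 quot_geometric //; lia.
step ((Q - 1) * (K - 1) - 2) => //; try solve_size.
step ((Q - 1) * (K - 1) * ((Q - 1) * (K - 1) - 2) + (Q + 1)) => //; try solve_size.
step (\sum_(i < K) i ^ 2 * Q ^ i) => //; try solve_size.
- by rewrite expn_gt0; lia.
- have [u def_u] : exists u, Q = u.+1 by exists Q.-1; lia.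
  have [t def_t] : exists t, K = t.+1 by exists K.-1; lia.
  rewrite def_t def_u !subn1 /=.
  have key : u ^ 3 * (\sum_(i < t.+1) i ^ 2 * u.+1 ^ i) + u.+1 * (u + 2)
             + 2 * (u * t) * u.+1 ^ t.+1
             = u.+1 ^ t.+1 * ((u * t) ^ 2 + (u + 2)).
    elim: t {def_t} => [|t IHt]; first by rewrite big_ord1 /=; ring.
    rewrite big_ord_recr [u.+1 ^ t.+2]expnS /=.
    move: (\sum_(i < t.+1) _) (u.+1 ^ t.+1) IHt => S Z IHt.
    apply: (@addnI (2 * (u * t) * Z)).
    transitivity (u ^ 3 * S + u.+1 * (u + 2) + 2 * (u * t) * Z
      + (u ^ 3 * t.+1 ^ 2 * Z + 2 * (u * t.+1) * (u.+1 * Z))); first by ring.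
    by rewrite IHt; ring.
  have -> : u.+1 ^ t.+1 * (u * t * (u * t - 2) + (u.+1 + 1))
            = (\sum_(i < t.+1) i ^ 2 * u.+1 ^ i) * u ^ 3 + u.+1 * (u + 2).
    move: (\sum_(i < t.+1) _) (u.+1 ^ t.+1) key => S Z key.
    have : u * t * (u * t - 2) + 2 * (u * t) = (u * t) ^ 2.
      have u_gt3 : 3 < u by lia.
      have [-> // | ] : u * t = 0 \/ 2 <= u * t.
        by case: (posnP t) => [-> | t_gt0]; [left; rewrite muln0 | right; nia].
      by move: (u * t) => v; nia.
    move: (u * t * (u * t - 2)) => vz def_vz.
    by rewrite -def_vz in key; lia.
  rewrite divnMDl ?divn_small ?addn0 //; last by rewrite expn_gt0; lia.
  by nia.
exact: computes_ret.
Qed.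

(** [digit_extract] reads 'C(2m, m) off the base-L digits of (L + 1) ^ (2m), its
    gcd with L is 2 ^ weight m, and raising this to the power 2m gives
    L ^ weight m, whose exponent is found modulo (L - 1) ^ 2. *)
Lemma Hw_correct m : 0 < m -> computes predT (Hw m) (weight m).
Proof.
move=> m_gt0; rewrite /Hw.
set L := 2 ^ (2 * m); have L_big : 2 * m < L by rewrite /L ltn_expl.
have bin_lt i : 'C(2 * m, i) < L by apply: bin_lt_expn2; lia.
have alpha_gt0 : 0 < 'C(2 * m, m) by rewrite bin_gt0; lia.
set alpha := 'C(2 * m, m) in alpha_gt0.
step (2 * m) => //.
step L => //.
step alpha => //.
- by rewrite expn_gt0 /L expn_gt0.
- by rewrite /L expn_gt0.
- rewrite addnC expnDn.
  rewrite (eq_bigr (fun i : 'I__ => 'C(2 * m, i) * L ^ i)); last first.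
    by move=> i _; rewrite exp1n mul1n.
  rewrite (digit_extract L _ (fun i => (binomial (2 * m) i))) //; lia.
step (2 * m) => //.
step L => //.
step (alpha * L) => //.
have X_gt0 n : 0 < 2 ^ n by rewrite expn_gt0.
have X_gt1 n : 0 < n -> 1 < 2 ^ n by move=> n_gt0; rewrite -{1}(expn0 2) ltn_exp2l.
have gamma_big : alpha + 3 < 2 ^ (alpha * L).
  have L_ge4 : 4 <= L by rewrite /L (@leq_exp2l 2 2) //; lia.
  by apply: leq_ltn_trans (ltn_expl _ _) => //; nia.
step (2 ^ weight m) => //.
- by rewrite muln_gt0 !subn_gt0 !X_gt1 // !muln_gt0 alpha_gt0; lia.
- have powE n : 2 ^ (alpha * L * n) = (2 ^ (alpha * L)) ^ n by rewrite expnM.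
  rewrite !subn1 !powE gcd_quotient ?alpha_gt0 ?bin_lt //=.
  rewrite gcdn_expn2 ?logn_central_bin //.
  by have := weight_le m; lia.
step L.-1 => //; first by rewrite subn1.
step (weight m) => //.
- by rewrite expn_gt0; lia.
- by lia.
- have -> : (2 ^ weight m) ^ (2 * m) = L.-1.+1 ^ weight m.
    by rewrite prednK -?expnM 1?mulnC // /L -?expnM //; lia.
  by rewrite expn_succ_mod //; have := weight_le m; lia.
exact: computes_ret.
Qed.

(** * Solutions of the Pell equation *)

Section Pell.

Variables d X1 Y1 : nat.

(** The coefficients of (X1 + Y1 sqrt d) ^ k. *)
Fixpoint pell_power (k : nat) : nat * nat :=
  if k is k'.+1 then
    let: (x, y) := pell_power k' in (X1 * x + d * Y1 * y, X1 * y + Y1 * x)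
  else (1, 0).

Definition pell_x k := (pell_power k).1.
Definition pell_y k := (pell_power k).2.

Lemma pell_xS k : pell_x k.+1 = X1 * pell_x k + d * Y1 * pell_y k.
Proof. by rewrite /pell_x /pell_y /=; case: pell_power. Qed.

Lemma pell_yS k : pell_y k.+1 = X1 * pell_y k + Y1 * pell_x k.
Proof. by rewrite /pell_x /pell_y /=; case: pell_power. Qed.

(** With the next lemma: multiplying the sum of the first n powers of
    X1 + Y1 sqrt d by this number shifts the sum by one index. *)
Lemma pell_sumX n :
  X1 * (\sum_(k < n) pell_x k) + d * Y1 * (\sum_(k < n) pell_y k) + 1
  = \sum_(k < n) pell_x k + pell_x n.
Proof.
elim: n => [|n IHn]; first by rewrite !big_ord0 !muln0.
rewrite !big_ord_recr /= pell_xS.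
by move: (\sum_(k < n) pell_x k) (\sum_(k < n) pell_y k) (pell_x n) (pell_y n) IHn; lia.
Qed.

Lemma pell_sumY n :
  X1 * (\sum_(k < n) pell_y k) + Y1 * (\sum_(k < n) pell_x k)
  = \sum_(k < n) pell_y k + pell_y n.
Proof.
elim: n => [|n IHn]; first by rewrite !big_ord0 !muln0.
rewrite !big_ord_recr /= pell_yS.
by move: (\sum_(k < n) pell_x k) (\sum_(k < n) pell_y k) (pell_x n) (pell_y n) IHn; lia.
Qed.

Hypothesis fundXY : fundamental_solution d X1 Y1.

Let X1Y1_norm : X1 ^ 2 = d * Y1 ^ 2 + 1.
Proof. by case: fundXY => [[]]. Qed.

Let Y1_gt0 : 0 < Y1. Proof. by case: fundXY => [[]]. Qed.

Hypothesis d_gt0 : 0 < d.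

Let X1_gt1 : 1 < X1.
Proof. by have dY_gt0 : 0 < d * Y1 ^ 2 by [rewrite muln_gt0 d_gt0 expn_gt0 Y1_gt0]; nia. Qed.

Lemma pell_power_norm k : pell_x k ^ 2 = d * pell_y k ^ 2 + 1.
Proof.
elim: k => [|k IHk]; first by rewrite muln0.
rewrite pell_xS pell_yS; move: (pell_x k) (pell_y k) IHk => x y IHk.
rewrite (_ : (_ + _) ^ 2 = X1 ^ 2 * x ^ 2 + d * Y1 ^ 2 * (d * y ^ 2)
                           + 2 * d * X1 * Y1 * x * y); last by ring.
by rewrite X1Y1_norm IHk; have := X1Y1_norm; nia.
Qed.

Lemma pell_x_double k : 2 * pell_x k <= pell_x k.+1.
Proof. by rewrite pell_xS; nia. Qed.

Lemma pell_x_gt0 k : 0 < pell_x k.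
Proof. by elim: k => //= k IHk; have := pell_x_double k; lia. Qed.

Lemma pell_x_mono : {mono pell_x : m n / m <= n}.
Proof.
apply: leq_mono; apply: homo_ltn => [? ? ?|k]; first exact: ltn_trans.
by have := pell_x_double k; have := pell_x_gt0 k; lia.
Qed.

Lemma pell_x_inj : injective pell_x.
Proof.
move=> m n eq_mn; apply/eqP.
by rewrite eqn_leq -(pell_x_mono m) -(pell_x_mono n) eq_mn leqnn.
Qed.

Lemma pell_y_lt k : pell_y k < pell_x k.
Proof. by have := pell_power_norm k; move: (pell_x k) (pell_y k); nia. Qed.

Lemma pell_sumX_lt n : \sum_(k < n.+1) pell_x k < 2 * pell_x n.
Proof.
elim: n => [|n IHn]; first by rewrite big_ord1.
rewrite big_ord_recr /=; have := pell_x_double n.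
by move: (\sum_(k < n.+1) pell_x k) (pell_x n) (pell_x n.+1) IHn; lia.
Qed.

(** Descent: dividing a solution with y > 0 by X1 + Y1 sqrt d yields the
    solution (X1 x - d Y1 y, X1 y - Y1 x), whose entries are natural numbers
    because (X1, Y1) is the least positive solution, and whose first entry is
    smaller than x. *)
Lemma pell_power_complete x y :
  x ^ 2 = d * y ^ 2 + 1 -> exists k, pell_power k = (x, y).
Proof.
elim/ltn_ind: x y => x IHx y normxy.
case: (posnP y) => [y0 | y_gt0].
  by exists 0; rewrite y0 in normxy *; congr (_, _); nia.
have x_gt0 : 0 < x by nia.
have le_X1 : X1 <= x by case: fundXY => _ /(_ x y); apply; split.
have X1n := X1Y1_norm.
have le_dY : d * Y1 ^ 2 <= d * y ^ 2.
  by have : X1 ^ 2 <= x ^ 2 by [rewrite leq_exp2r]; rewrite X1n normxy; lia.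
have le_Y1 : Y1 ^ 2 <= y ^ 2 by move: le_dY; rewrite leq_pmul2l.
have [s def_s] : exists s, X1 = s.+1 by exists X1.-1; lia.
have normX : d * Y1 ^ 2 = s ^ 2 + 2 * s by move: X1n; rewrite def_s; lia.
have le_y : Y1 * x <= X1 * y.
  by rewrite -(@leq_exp2r _ _ 2) // !expnMn X1n normxy; lia.
have lt_x : d * Y1 * y <= X1 * x.
  by rewrite -(@leq_exp2r _ _ 2) // !expnMn X1n normxy; lia.
(* Equivalent to x' < x for the quotient (x', y') of the solution below. *)
have lt_sx : s * x < d * Y1 * y.
  rewrite -(@ltn_exp2r _ _ 2) // !expnMn normxy.
  have -> : d ^ 2 * Y1 ^ 2 * y ^ 2 = d * Y1 ^ 2 * (d * y ^ 2) by ring.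
  rewrite normX; move: le_dY; rewrite normX; nia.
have [x' def_x'] : exists x', X1 * x = d * Y1 * y + x' by exists (X1 * x - d * Y1 * y); lia.
have [y' def_y'] : exists y', X1 * y = Y1 * x + y' by exists (X1 * y - Y1 * x); lia.
have def_x : X1 * x' + d * Y1 * y' = x.
  have e1 : X1 * (X1 * x) = X1 * (d * Y1 * y + x') by rewrite def_x'.
  have e2 : d * Y1 * (X1 * y) = d * Y1 * (Y1 * x + y') by rewrite def_y'.
  have e3 : X1 ^ 2 * x = (d * Y1 ^ 2 + 1) * x by rewrite X1n.
  lia.
have def_y : X1 * y' + Y1 * x' = y.
  have e1 : Y1 * (X1 * x) = Y1 * (d * Y1 * y + x') by rewrite def_x'.
  have e2 : X1 * (X1 * y) = X1 * (Y1 * x + y') by rewrite def_y'.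
  have e3 : X1 ^ 2 * y = (d * Y1 ^ 2 + 1) * y by rewrite X1n.
  lia.
have norm' : x' ^ 2 = d * y' ^ 2 + 1.
  have e1 : X1 ^ 2 * x' ^ 2 = (d * Y1 ^ 2 + 1) * x' ^ 2 by rewrite X1n.
  have e2 : d * (X1 ^ 2 * y' ^ 2) = d * ((d * Y1 ^ 2 + 1) * y' ^ 2) by rewrite X1n.
  move: normxy; rewrite -def_x -def_y; lia.
have lt_x' : x' < x by move: def_x'; rewrite def_s; lia.
have [k def_k] := IHx x' lt_x' y' norm'.
by exists k.+1; rewrite /= def_k def_x def_y.
Qed.

Lemma pell_count K : exists n, forall k, (pell_x k < K) = (k < n).
Proof.
have ex_n : exists n, K <= pell_x n.
  exists K; elim: K => // k IHk; apply: leq_ltn_trans IHk _.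
  by rewrite ltnNge pell_x_mono ltnn.
case: (ex_minnP ex_n) => n le_Kn min_n; exists n => k; apply/idP/idP => [lt_k | lt_kn].
  by rewrite ltnNge; apply: contraL lt_k => le_nk; rewrite -leqNgt (leq_trans le_Kn) ?pell_x_mono.
by rewrite ltnNge; apply: contraL lt_kn => /min_n; rewrite -leqNgt.
Qed.

(** The solutions in the box x, y < K are the n first powers: y < K follows from
    x < K, and distinct powers have distinct first entries. *)
Lemma sum_pell_solutions K n (f : nat -> nat -> nat) :
  (forall k, (pell_x k < K) = (k < n)) ->
  \sum_(x < K) \sum_(y < K) (x ^ 2 == d * y ^ 2 + 1) * f x y
  = \sum_(k < n) f (pell_x k) (pell_y k).
Proof.
move=> ltK.
have indicator (x y : 'I_K) : (x ^ 2 == d * y ^ 2 + 1) * f x y =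
   \sum_(k < n) ((pell_x k == x) && (pell_y k == y)) * f (pell_x k) (pell_y k).
  case: eqP => [/pell_power_complete[k def_k] | not_sol].
    have [def_x def_y] : pell_x k = x /\ pell_y k = y by rewrite /pell_x /pell_y def_k.
    have lt_kn : k < n by rewrite -ltK def_x.
    rewrite (bigD1 (Ordinal lt_kn)) //= def_x def_y !eqxx big1 ?addn0 //.
    move=> j /eqP neq_j; case: eqP => //= eq_x; case: neq_j; apply: val_inj => /=.
    by apply: pell_x_inj; rewrite eq_x def_x.
  rewrite big1 // => k _; case: eqP => //= eq_x; case: eqP => //= eq_y.
  by case: not_sol; rewrite -eq_x -eq_y pell_power_norm.
rewrite (eq_bigr _ (fun x _ => eq_bigr _ (fun y _ => indicator x y))).
rewrite (eq_bigr _ (fun x _ => exchange_big _ _ _ _ _ _)) exchange_big /=.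
apply: eq_bigr => k _; have lt_xK : pell_x k < K by rewrite ltK.
have lt_yK : pell_y k < K by apply: ltn_trans (pell_y_lt k) lt_xK.
rewrite (bigD1 (Ordinal lt_xK)) //= (bigD1 (Ordinal lt_yK)) //= !eqxx mul1n.
rewrite !big1 ?addn0 // => [x neq_x|y neq_y].
  rewrite big1 // => y _; case: eqP => //= eq_x.
  by case/eqP: neq_x; apply: val_inj.
case: eqP => //= eq_y.
by case/eqP: neq_y; apply: val_inj.
Qed.

(** Let s = X1 - 1 and c = A ^ 2 - A - d B ^ 2.  The n-th power of the
    fundamental unit has coefficients s A + d Y1 B + 1 and s B + Y1 A; that its
    norm is 1 simplifies to s c = d Y1 B.  Squaring and using
    d Y1 ^ 2 = s (s + 2) gives s c ^ 2 = (s + 2) d B ^ 2.  With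
    D = c ^ 2 - d B ^ 2 this says s D = 2 d B ^ 2 > 0, so
    c ^ 2 + d B ^ 2 = X1 D and 2 B c = Y1 D. *)
Lemma Rec_correct E n : 1 < n ->
  let A := \sum_(k < n) pell_x k in
  let B := \sum_(k < n) pell_y k in
  0 < E -> small E 1 d -> small E 2 A -> small E 2 B ->
  computes (small E 500) (Rec d A B) (X1, Y1).
Proof.
move=> n_gt1 A B E_gt0 size_d.
have eqX := pell_sumX n; have eqY := pell_sumY n; have normn := pell_power_norm n.
rewrite -/A -/B in eqX eqY.
have B_gt0 : 0 < B.
  rewrite /B (bigD1 (Ordinal n_gt1)) //= ltn_addr //.
  by rewrite /pell_y /= !muln0 add0n muln1.
move: A B (pell_x n) (pell_y n) B_gt0 eqX eqY normn => A B x y B_gt0 eqX eqY normn size_A size_B.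
have [s def_s] : exists s, X1 = s.+1 by exists X1.-1; lia.
have s_gt0 : 0 < s by lia.
have normX : d * Y1 ^ 2 = s ^ 2 + 2 * s by move: X1Y1_norm; rewrite def_s; lia.
have key : s * A ^ 2 = s * (A + d * B ^ 2) + d * Y1 * B.
  have def_x : x = s * A + d * Y1 * B + 1 by move: eqX; rewrite def_s; lia.
  have def_y : y = s * B + Y1 * A by move: eqY; rewrite def_s; lia.
  rewrite def_x def_y in normn.
  have normA : d * Y1 ^ 2 * A ^ 2 = (s ^ 2 + 2 * s) * A ^ 2 by rewrite normX.
  have normB : d * Y1 ^ 2 * (d * B ^ 2) = (s ^ 2 + 2 * s) * (d * B ^ 2).
    by rewrite normX.
  have : 2 * s * A ^ 2 = 2 * s * (A + d * B ^ 2) + 2 * (d * Y1 * B) by lia.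
  lia.
set c := A * A - A - d * (B * B).
have sc : s * c = d * Y1 * B.
  by rewrite /c !mulnBr; move: key; rewrite mulnDr; lia.
have Vc : s * (c * c) = (s + 2) * (d * (B * B)).
  apply/eqP; rewrite -(eqn_pmul2l s_gt0); apply/eqP.
  have -> : s * (s * (c * c)) = (s * c) * (s * c) by ring.
  rewrite sc.
  have -> : d * Y1 * B * (d * Y1 * B) = (d * Y1 ^ 2) * (d * (B * B)) by ring.
  by rewrite normX; ring.
have V_gt0 : 0 < d * (B * B) by rewrite !muln_gt0 d_gt0 B_gt0.
have sD : s * (c * c - d * (B * B)) = 2 * (d * (B * B)).
  by rewrite mulnBr Vc; lia.
have D_gt0 : 0 < c * c - d * (B * B).
  by rewrite -(ltn_pmul2l s_gt0) muln0 sD; lia.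
have size_c : small E 4 c by rewrite /c; solve_size.
rewrite /Rec.
step (d * (B * B)) => //; try solve_size.
step c => //; try solve_size.
step (c * c) => //; try solve_size.
step (c * c - d * (B * B)) => //; try solve_size.
step X1 => //; try solve_size.
  have -> : c * c + d * (B * B) = X1 * (c * c - d * (B * B)).
    apply/eqP; rewrite -(eqn_pmul2l s_gt0) mulnDr Vc [s * (X1 * _)]mulnCA sD def_s; apply/eqP.
    by ring.
  by rewrite mulnK.
step Y1 => //; try solve_size.
  have -> : 2 * B * c = Y1 * (c * c - d * (B * B)).
    apply/eqP; rewrite -(eqn_pmul2l s_gt0) mulnCA sc [s * _]mulnCA sD; apply/eqP.
    by ring.
  by rewrite mulnK.
exact: computes_ret.
Qed.

End Pell.

(** * The packed integer and its weight *)

(** After the division each coefficient c x y occurs at the positions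
    y + K x + K ^ 2 j for j < k x y.  These are distinct for distinct triples,
    so the base-2 ^ e digits of M are the numbers [a j x y] below.  The factor
    2 in the bound for c keeps the sum of the remainders below q2 - 1. *)
Lemma packed_quotient e K J (c k : nat -> nat -> nat) :
  0 < e -> 0 < K ->
  (forall x y, x < K -> y < K -> 2 * c x y < 2 ^ e) ->
  (forall x y, x < K -> y < K -> k x y <= J) ->
  let q2 := ((2 ^ e) ^ K) ^ K in
  let M := (\sum_(x < K) \sum_(y < K)
              c x y * (2 ^ e) ^ y * ((2 ^ e) ^ K) ^ x * q2 ^ k x y) %/ q2.-1 in
  M < q2 ^ J
  /\ weight M = \sum_(x < K) \sum_(y < K) k x y * weight (c x y).
Proof.
move=> e_gt0 K_gt0 lt_c le_k; set q := 2 ^ e; set q1 := q ^ K => q2 M.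
pose block (a : nat -> nat -> nat) :=
  \sum_(x < K) (\sum_(y < K) a x y * q ^ y) * q1 ^ x.
have block_lt a : (forall x y, x < K -> y < K -> a x y < q) -> block a < q2.
  move=> lt_a; apply: (sum_digits_lt q1 K (fun x => \sum_(y < K) a x y * q ^ y)).
  by move=> x lt_x; apply: (sum_digits_lt q K (a x)) => y; apply: lt_a.
pose a j x y := (j < k x y) * c x y.
have lt_a j x y : x < K -> y < K -> a j x y < q.
  by move=> lt_x lt_y; have := lt_c x y lt_x lt_y; rewrite /a /q; case: (j < _); lia.
have M_digits : M = \sum_(j < J) block (a j) * q2 ^ j.
  rewrite /M pair_big /= quot_repunits.
    rewrite -(pair_big xpredT xpredT (fun x y : 'I_K =>
      c x y * q ^ y * q1 ^ x * \sum_(j < k x y) q2 ^ j)) /=.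
    rewrite (eq_bigr (fun j : 'I_J => \sum_(x < K) \sum_(y < K)
      c x y * q ^ y * q1 ^ x * ((j < k x y) * q2 ^ j))); last first.
      move=> j _; rewrite big_distrl; apply: eq_bigr => x _ /=.
      rewrite !big_distrl; apply: eq_bigr => y _ /=; rewrite /a; ring.
    rewrite [RHS]exchange_big; apply: eq_bigr => x _ /=.
    rewrite [RHS]exchange_big; apply: eq_bigr => y _ /=.
    rewrite -big_distrr /=; congr (_ * _).
    rewrite (big_ord_widen _ (fun j => q2 ^ j) (le_k _ _ (ltn_ord x) (ltn_ord y))).
    by rewrite big_mkcond; apply: eq_bigr => j _; case: (j < _); rewrite ?mul1n.
  rewrite -(pair_big xpredT xpredT (fun x y : 'I_K => c x y * q ^ y * q1 ^ x)) /=.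
  have -> : \sum_(x < K) \sum_(y < K) c x y * q ^ y * q1 ^ x = block c.
    by apply: eq_bigr => x _; rewrite big_distrl.
  (* 2 c x y is still a digit, so the remainders add up to less than q2 / 2. *)
  have : block (fun x y => 2 * c x y) < q2 by apply: block_lt.
  have -> : block (fun x y => 2 * c x y) = 2 * block c.
    rewrite /block big_distrr; apply: eq_bigr => x _ /=.
    rewrite mulnA; congr (_ * _); rewrite big_distrr; apply: eq_bigr => y _ /=.
    by rewrite mulnA.
  have : 1 < q2.
    by rewrite /q2 /q1 /q -!expnM -{1}(expn0 2) ltn_exp2l // !muln_gt0 e_gt0 K_gt0.
  by move: (block c) => b; clear; clearbody q2; lia.
rewrite M_digits; split.
  by apply: (sum_digits_lt q2 J (fun j => block (a j))) => j _; apply: block_lt (lt_a j).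
have -> : q2 = 2 ^ (e * K * K) by rewrite !expnM.
rewrite (weight_digits _ J (fun j => block (a j))); last first.
  by move=> j _; rewrite !expnM; apply: block_lt (lt_a j).
have weight_block j : weight (block (a j))
    = \sum_(x < K) \sum_(y < K) (j < k x y) * weight (c x y).
  rewrite /block; have -> : q1 = 2 ^ (e * K) by rewrite expnM.
  rewrite (weight_digits _ K (fun x => \sum_(y < K) a j x y * q ^ y)); last first.
    move=> x lt_x; rewrite expnM.
    by apply: (sum_digits_lt q K (a j x)) => y; apply: lt_a lt_x.
  apply: eq_bigr => x _; rewrite (weight_digits _ K (a j x)); last first.
    by move=> y; apply: lt_a (ltn_ord x).
  by apply: eq_bigr => y _; rewrite /a; case: (j < _); rewrite ?mul1n.
rewrite (eq_bigr _ (fun (j : 'I_J) _ => weight_block j)) exchange_big.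
apply: eq_bigr => x _; rewrite exchange_big; apply: eq_bigr => y _ /=.
rewrite -big_distrl /=; congr (_ * _).
have le_kJ := le_k _ _ (ltn_ord x) (ltn_ord y).
transitivity (\sum_(j < k x y) 1); last by rewrite sum_nat_const card_ord muln1.
by rewrite (big_ord_widen _ (fun=> 1) le_kJ) [RHS]big_mkcond; apply: eq_bigr => j _; case: (j < _).
Qed.

(** U = q1 q2 and V = q q2 ^ (2 K) are chosen such that
    U ^ x V ^ y = q ^ y q1 ^ x q2 ^ (x + 2 K y). *)
Lemma packed_sum d K P q q1 q2 :
  (forall x, x < K -> x ^ 2 <= P + 2) ->
  let U := q1 * q2 in
  let V := q * (q2 ^ K * q2 ^ K) in
  (P - 1) * ((\sum_(y < K) V ^ y)
               * ((P + 2) * (\sum_(x < K) U ^ x) - \sum_(x < K) x ^ 2 * U ^ x)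
             + (\sum_(x < K) U ^ x) * (d * \sum_(y < K) y ^ 2 * V ^ y))
  = \sum_(x < K) \sum_(y < K)
      (P - 1) * (P + 1 + (d * y ^ 2 + 1) - x ^ 2) * q ^ y * q1 ^ x
      * q2 ^ (x + 2 * K * y).
Proof.
move=> le_x U V.
have -> : (P + 2) * (\sum_(x < K) U ^ x) - \sum_(x < K) x ^ 2 * U ^ x
          = \sum_(x < K) (P + 2 - x ^ 2) * U ^ x.
  rewrite big_distrr -sumnB => [|x _] /=; last by rewrite leq_mul2r le_x ?orbT.
  by apply: eq_bigr => x _; rewrite mulnBl.
rewrite [_ * \sum_(x < K) (_ - _) * _]mulnC [d * _]big_distrr !big_distrlr /=.
rewrite -big_split big_distrr; apply: eq_bigr => x _ /=.
rewrite -big_split big_distrr; apply: eq_bigr => y _ /=.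
have -> : P + 1 + (d * y ^ 2 + 1) - x ^ 2 = P + 2 - x ^ 2 + d * y ^ 2.
  by have := le_x x (ltn_ord x); lia.
have -> : q2 ^ (x + 2 * K * y) = q2 ^ x * ((q2 ^ K) ^ y * (q2 ^ K) ^ y).
  by rewrite -!expnM -!expnD; congr (_ ^ _); ring.
by rewrite /U /V !expnMn; ring.
Qed.

Lemma double_sum_nat n : 2 * (\sum_(i < n) i) = n * (n - 1).
Proof.
elim: n => [|n IHn]; first by rewrite big_ord0.
by rewrite big_ord_recr mulnDr IHn /=; nia.
Qed.

Lemma sum_copies K :
  \sum_(x < K) \sum_(y < K) (x + 2 * K * y)
  = (2 * K + 1) * (K * K * (K - 1) %/ 2).
Proof.
have -> : K * K * (K - 1) %/ 2 = K * \sum_(i < K) i.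
  by rewrite -mulnA -double_sum_nat mulnCA mulKn.
rewrite (eq_bigr (fun x : 'I_K => K * x + 2 * K * \sum_(y < K) y)); last first.
  by move=> x _; rewrite big_split big_distrr sum_nat_const card_ord.
rewrite big_split -big_distrr sum_nat_const card_ord /=.
by move: (\sum_(i < K) i) => S; ring.
Qed.

(** For fixed y the numbers of copies x + 2 K y are at most K (2 y + 1), the valuations
    sum to at most 8 K, and the odd numbers 2 y + 1 with y < K sum to
    K ^ 2. *)
Lemma excess_bound d K :
  (forall y, y < K -> d * y ^ 2 + 1 <= K ^ 4) ->
  \sum_(x < K) \sum_(y < K) (x + 2 * K * y) * logn 2 (d * y ^ 2 + 1 - x ^ 2)
  <= 8 * K ^ 4.
Proof.
move=> le_m; rewrite exchange_big /=.
apply: (@leq_trans (\sum_(y < K) K * (2 * y + 1) * (8 * K))).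
  apply: leq_sum => y _.
  apply: leq_trans (_ : K * (2 * y + 1) * \sum_(x < K) logn 2 (d * y ^ 2 + 1 - x ^ 2) <= _).
    rewrite big_distrr; apply: leq_sum => x _ /=; rewrite leq_mul2r.
    by apply/orP; right; move: (ltn_ord x); move: (nat_of_ord x) (nat_of_ord y); lia.
  by rewrite leq_mul2l sum_logn_sub_squares ?orbT // le_m.
rewrite -big_distrl -big_distrr big_split -big_distrr /= double_sum_nat.
rewrite sum_nat_const card_ord muln1.
by case: K {le_m} => // K; rewrite leq_eqVlt; apply/orP; left; apply/eqP; rewrite subn1 /=; ring.
Qed.

(** The quotient by w discards the excess, which is smaller than w, and leaves
    one copy number for each pair and one more for each solution. *)
Lemma packed_weight_quotient d K w n (X Y : nat -> nat) :
  0 < w -> 8 * K ^ 4 < w ->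
  (forall y, y < K -> d * y ^ 2 + 1 <= K ^ 4) ->
  (forall f : nat -> nat -> nat,
     \sum_(x < K) \sum_(y < K) (x ^ 2 == d * y ^ 2 + 1) * f x y
     = \sum_(k < n) f (X k) (Y k)) ->
  (\sum_(x < K) \sum_(y < K) (x + 2 * K * y)
     * (w + (x ^ 2 == d * y ^ 2 + 1) * w + logn 2 (d * y ^ 2 + 1 - x ^ 2))) %/ w
  = (2 * K + 1) * (K * K * (K - 1) %/ 2)
    + (\sum_(k < n) X k + 2 * K * \sum_(k < n) Y k).
Proof.
move=> w_gt0 lt_w le_m sum_sol.
have -> : \sum_(x < K) \sum_(y < K) (x + 2 * K * y)
     * (w + (x ^ 2 == d * y ^ 2 + 1) * w + logn 2 (d * y ^ 2 + 1 - x ^ 2))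
  = (\sum_(x < K) \sum_(y < K) (x + 2 * K * y)
     + \sum_(x < K) \sum_(y < K) (x ^ 2 == d * y ^ 2 + 1) * (x + 2 * K * y)) * w
    + \sum_(x < K) \sum_(y < K) (x + 2 * K * y) * logn 2 (d * y ^ 2 + 1 - x ^ 2).
  rewrite mulnDl !big_distrl -!big_split; apply: eq_bigr => x _ /=.
  rewrite !big_distrl -!big_split; apply: eq_bigr => y _ /=; ring.
rewrite divnMDl // divn_small ?addn0; last first.
  by apply: leq_ltn_trans lt_w; apply: excess_bound.
by rewrite sum_copies (sum_sol (fun x y => x + 2 * K * y)) big_split -big_distrr.
Qed.

(** The factor 2 on the left is the margin asked for by [packed_quotient]. *)
Lemma pell_digit_lt P d x y :
  4 <= P -> d * y ^ 2 + 1 < P ->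
  2 * ((P - 1) * (P + 1 + (d * y ^ 2 + 1) - x ^ 2)) < P ^ 3.
Proof.
move=> P_ge4; move: (d * y ^ 2 + 1) (x ^ 2) => m s lt_m.
apply: (@leq_ltn_trans (2 * ((P - 1) * (2 * P)))).
  by rewrite !leq_mul2l; apply/orP; right; apply/orP; right; lia.
have -> : P ^ 3 = P * (P * P) by ring.
apply: (@leq_trans (4 * (P * P))); last by rewrite leq_mul2r P_ge4 orbT.
by nia.
Qed.

(** X1 < K bounds d, as d Y1 ^ 2 = X1 ^ 2 - 1. *)
Lemma fundamental_le d X1 Y1 K y :
  fundamental_solution d X1 Y1 -> X1 < K -> y < K ->
  d <= K ^ 2 /\ d * y ^ 2 + 1 <= K ^ 4.
Proof.
move=> [[_ Y1_gt0 X1n] _] lt_XK lt_yK.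
have le_d : d + 1 <= (K - 1) ^ 2.
  apply: (@leq_trans (X1 ^ 2)); last by rewrite leq_exp2r //; lia.
  by rewrite X1n leq_add2r -{1}(muln1 d) leq_mul2l expn_gt0 Y1_gt0 orbT.
have [k def_K] : exists k, K = k.+1 by exists K.-1; lia.
rewrite def_K subn1 /= in le_d lt_yK *; split; first by nia.
apply: (@leq_trans (k ^ 2 * k ^ 2 + 1)); last by lia.
by rewrite leq_add2r leq_mul ?leq_exp2r //; lia.
Qed.

Lemma packed_integer_spec d X1 Y1 K w n q q1 q2 q3 :
  0 < d -> fundamental_solution d X1 Y1 -> X1 < K -> w = 16 * K ^ 4 ->
  (forall k, (pell_x d X1 Y1 k < K) = (k < n)) ->
  q = 2 ^ (w * 3) -> q1 = q ^ K -> q2 = q1 ^ K -> q3 = q2 ^ K ->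
  let U := q1 * q2 in
  let V := q * (q3 * q3) in
  let M := ((2 ^ w - 1)
     * ((\sum_(y < K) V ^ y)
          * ((2 ^ w + 2) * (\sum_(x < K) U ^ x) - \sum_(x < K) x ^ 2 * U ^ x)
        + (\sum_(x < K) U ^ x) * (d * \sum_(y < K) y ^ 2 * V ^ y))) %/ q2.-1 in
  M < q2 ^ (2 * K * K) /\
  weight M %/ w = (2 * K + 1) * (K * K * (K - 1) %/ 2)
    + (\sum_(k < n) pell_x d X1 Y1 k + 2 * K * \sum_(k < n) pell_y d X1 Y1 k).
Proof.
move=> d_gt0 fundXY lt_XK def_w count_n def_q def_q1 def_q2 def_q3.
have K_gt0 : 0 < K by apply: leq_ltn_trans lt_XK.
have K4_gt0 : 0 < K ^ 4 by rewrite expn_gt0 K_gt0.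
have w_gt0 : 0 < w by rewrite def_w muln_gt0.
have w_gt : 8 * K ^ 4 < w by rewrite def_w ltn_pmul2r.
have lt_wP : w < 2 ^ w by apply: ltn_expl.
have le_m y : y < K -> d * y ^ 2 + 1 <= K ^ 4.
  by move=> lt_y; case: (fundamental_le d X1 Y1 K y).
have lt_P m : m <= K ^ 4 -> m < 2 ^ w.
  by move=> le_mK; apply: leq_ltn_trans lt_wP; rewrite def_w (leq_trans le_mK) ?leq_pmull.
have le_x2 x : x < K -> x ^ 2 <= 2 ^ w.
  move=> lt_x; apply/ltnW/lt_P; apply: (@leq_trans (K ^ 2)).
    by rewrite leq_exp2r // ltnW.
  by rewrite leq_pexp2l.
have P_ge4 : 4 <= 2 ^ w.
  by apply: leq_trans (ltnW lt_wP); rewrite def_w; clear -K4_gt0; lia.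
pose c x y := (2 ^ w - 1) * (2 ^ w + 1 + (d * y ^ 2 + 1) - x ^ 2).
have lt_c x y : x < K -> y < K -> 2 * c x y < 2 ^ (w * 3).
  by move=> _ lt_y; rewrite expnM; apply: pell_digit_lt => //; apply: lt_P (le_m y lt_y).
have le_k x y : x < K -> y < K -> x + 2 * K * y <= 2 * K * K.
  by clear; nia.
have e_gt0 : 0 < w * 3 by rewrite muln_gt0 w_gt0.
have := packed_quotient (w * 3) K (2 * K * K) c (fun x y => x + 2 * K * y)
          e_gt0 K_gt0 lt_c le_k.
rewrite /= -def_q -def_q1 -def_q2 -(packed_sum d K (2 ^ w) q q1 q2); last first.
  by move=> x lt_x; apply: leq_trans (le_x2 x lt_x) (leq_addr _ _).
rewrite -def_q3 => -[lt_M ->]; split=> //.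
rewrite -(packed_weight_quotient d K w n (pell_x d X1 Y1) (pell_y d X1 Y1) w_gt0 w_gt le_m).
  congr (_ %/ _); apply: eq_bigr => x _; apply: eq_bigr => y _; congr (_ * _).
  by rewrite /c weight_pell_digit ?le_x2 // lt_P ?le_m.
by move=> f; apply: sum_pell_solutions.
Qed.

(** * The whole program *)

(** Each of these numbers is 2 ^ (48 K ^ i) for some i, and i = 8 occurs only for
    the last one; 48 <= K absorbs the constant of the others. *)
Lemma power_tower_small K w E q q1 q2 q3 :
  64 <= K -> w = 16 * K ^ 4 -> E = K ^ 8 ->
  q = 2 ^ (w * 3) -> q1 = q ^ K -> q2 = q1 ^ K -> q3 = q2 ^ K ->
  [/\ small E 1 q, small E 1 q1, small E 1 q2, small E 1 q3 & small E 48 (q3 ^ K)].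
Proof.
move=> le_64K def_w -> def_q def_q1 def_q2 def_q3.
have qE : q = 2 ^ (48 * K ^ 4).
  by rewrite def_q def_w; congr (_ ^ _); ring.
have q1E : q1 = 2 ^ (48 * K ^ 5) by rewrite def_q1 qE -expnM -mulnA -expnSr.
have q2E : q2 = 2 ^ (48 * K ^ 6) by rewrite def_q2 q1E -expnM -mulnA -expnSr.
have q3E : q3 = 2 ^ (48 * K ^ 7) by rewrite def_q3 q2E -expnM -mulnA -expnSr.
have size_pow i : i <= 7 -> small (K ^ 8) 1 (2 ^ (48 * K ^ i)).
  move=> le_i; rewrite /small leq_exp2l // mul1n (expnS K 7) leq_mul //.
    by apply: leq_trans le_64K.
  by rewrite leq_exp2l //; apply: leq_trans le_64K.
have size_q4 : small (K ^ 8) 48 (q3 ^ K).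
  by rewrite q3E -expnM -mulnA -expnSr /small leqnn.
by split=> //; rewrite (qE, q1E, q2E, q3E); apply: size_pow.
Qed.

Lemma SC_correct d X1 Y1 K w :
  0 < d -> fundamental_solution d X1 Y1 -> X1 < K -> 64 <= K -> w = (2 * K) ^ 4 ->
  exists2 M, M < 2 ^ (3 * w * (2 * K + 1) * K ^ 3) &
    computes (small (K ^ 8) 500) (SC d K w) (M, (X1, Y1)).
Proof.
move=> d_gt0 fundXY lt_XK le_64K def_w0.
have def_w : w = 16 * K ^ 4 by rewrite def_w0 expnMn.
have K_gt0 : 0 < K by apply: leq_trans le_64K.
(* The powers are named by equations, not by local definitions, to keep the
   arithmetic tactics from unfolding them. *)
have [q def_q] : exists q, q = 2 ^ (w * 3) by exists (2 ^ (w * 3)).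
have [q1 def_q1] : exists q1, q1 = q ^ K by exists (q ^ K).
have [q2 def_q2] : exists q2, q2 = q1 ^ K by exists (q1 ^ K).
have [q3 def_q3] : exists q3, q3 = q2 ^ K by exists (q2 ^ K).
have [E def_E] : exists E, E = K ^ 8 by exists (K ^ 8).
have [size_q size_q1 size_q2 size_q3 size_q4] :=
  power_tower_small K w E q q1 q2 q3 le_64K def_w def_E def_q def_q1 def_q2 def_q3.
have E_gt0 : 0 < E by rewrite def_E expn_gt0 K_gt0.
have small_E1 v i : v <= K ^ i -> i <= 8 -> small E 1 v.
  move=> le_v le_i; rewrite /small mul1n (leq_trans le_v) // ltnW //.
  by apply: leq_ltn_trans (ltn_expl E (isT : 1 < 2)); rewrite def_E leq_pexp2l.
have size_K : small E 1 K by apply: (small_E1 _ 1).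
have size_d : small E 1 d.
  by apply: (small_E1 _ 2) => //; case: (fundamental_le d X1 Y1 K 0).
have size_P : small E 1 (2 ^ w).
  by apply: (small_le _ _ _ _ size_q); rewrite def_q leq_exp2l // leq_pmulr.
have size_ZU : small E 97 ((q1 * q2) ^ K).
  by rewrite expnMn -def_q2 -def_q3; solve_size.
(* (q q3^2)^K = q1 (q3^K)^2 accounts for the constant 97 = 1 + 48 + 48. *)
have size_ZV : small E 97 ((q * (q3 * q3)) ^ K).
  by rewrite !expnMn -def_q1; solve_size.
have q_big : 4 < q.
  have w_gt0 : 0 < w by rewrite def_w muln_gt0 expn_gt0 K_gt0.
  rewrite def_q; apply: (@leq_trans (2 ^ 3)) => //.
  by rewrite leq_exp2l // leq_pmull.
have exp_big Q : 4 < Q -> 4 < Q ^ K.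
  move=> ltQ; apply: (leq_trans ltQ).
  by rewrite -{1}(expn1 Q) leq_pexp2l // (ltn_trans _ ltQ).
have q1_big : 4 < q1 by rewrite def_q1 exp_big.
have q2_big : 4 < q2 by rewrite def_q2 exp_big.
have q3_big : 4 < q3 by rewrite def_q3 exp_big.
have U_big : 4 < q1 * q2.
  by apply: (leq_trans q1_big); rewrite leq_pmulr // (ltn_trans _ q2_big).
have V_big : 4 < q * (q3 * q3).
  by apply: (leq_trans q_big); rewrite leq_pmulr // muln_gt0 andbb (ltn_trans _ q3_big).
have [size_U0 size_U2] := G02_values_small E _ K E_gt0 size_K size_ZU U_big.
have [size_V0 size_V2] := G02_values_small E _ K E_gt0 size_K size_ZV V_big.
have [n count_n] := pell_count d X1 Y1 fundXY d_gt0 K.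
have n_gt1 : 1 < n by rewrite -count_n pell_xS /pell_x /pell_y /= muln0 addn0 muln1.
have [] := packed_integer_spec d X1 Y1 K w n q q1 q2 q3 d_gt0 fundXY lt_XK def_w
  count_n def_q def_q1 def_q2 def_q3.
set Ts := _ * (_ + _); set M := Ts %/ q2.-1 => lt_M weightM.
set A := \sum_(k < n) pell_x d X1 Y1 k in weightM.
set B := \sum_(k < n) pell_y d X1 Y1 k in weightM.
have lt_A : A < 2 * K.
  rewrite /A; case: (n) n_gt1 count_n => // n' _ count_n.
  apply: leq_trans (pell_sumX_lt d X1 Y1 fundXY d_gt0 n') _.
  by rewrite leq_mul2l /= ltnW // count_n.
have lt_B : B < 2 * K.
  apply: leq_ltn_trans lt_A; apply: leq_sum => k _.
  exact/ltnW/pell_y_lt.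
have A_gt0 : 0 < A.
  by rewrite /A (bigD1 (Ordinal (ltnW n_gt1))).
have C_gt0 : 0 < 2 * K by rewrite muln_gt0.
have size_2K v : v < 2 * K -> small E 2 v.
  move=> lt_v; apply: (small_weaken _ _ (small_E1 v 2 _ _)) => //.
  by apply: leq_trans (ltnW lt_v) _; rewrite expnS expn1 leq_mul2r (leq_trans _ le_64K) ?orbT.
have size_A := size_2K A lt_A; have size_B := size_2K B lt_B.
have M_gt0 : 0 < M.
  by case: (posnP M) weightM => // ->; rewrite div0n; move: A_gt0; case: (A) => // a; rewrite addSn addnS.
exists M.
  apply: leq_trans lt_M _.
  rewrite def_q2 def_q1 def_q -!expnM leq_exp2l // (expnS K 2) expnS expn1.
  by clear; nia.
rewrite -def_E /SC.
step (K - 1) => //; try solve_size.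
step (2 ^ w) => //; try solve_size.
step (2 ^ w - 1) => //; try solve_size.
step q => //; try solve_size; first by rewrite def_q expnM.
step q1 => //; try solve_size; first by rewrite -def_q1; solve_size.
step q2 => //; try solve_size; first by rewrite -def_q2; solve_size.
step q3 => //; try solve_size; first by rewrite -def_q3; solve_size.
step (q1 * q2) => //; try solve_size.
step (q * (q3 * q3)) => //; try solve_size.
apply: (computes_bind _ _ _ _ (G02_correct E _ _ K_gt0 U_big E_gt0 size_K _ size_ZU)).
  solve_size.
apply: (computes_bind _ _ _ _ (G02_correct E _ _ K_gt0 V_big E_gt0 size_K _ size_ZV)).
  solve_size.
have size_Ts : small E 300 Ts by rewrite /Ts; solve_size.
step Ts => //; try (rewrite ?/Ts; solve_size).
step M => //; try solve_size.
- by rewrite subn_gt0 (ltn_trans _ q2_big).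
- by rewrite /M subn1.
have size_M : small E 300 M by rewrite /M; solve_size.
have size_H : small E 300 (weight M) by apply: (small_le _ _ _ _ size_M (weight_le M)).
apply: (computes_bind _ _ _ _ (computes_hide (Hw_correct M M_gt0) _)); first by solve_size.
step (2 * K) => //; try solve_size.
step (K * K * (K - 1) %/ 2) => //; try solve_size.
step (2 * K + 1) => //; try solve_size.
step ((2 * K + 1) * (K * K * (K - 1) %/ 2)) => //; try solve_size.
step (A + 2 * K * B) => //; try solve_size.
- by rewrite def_w muln_gt0 expn_gt0 K_gt0.
- by rewrite weightM addKn.
step A => //; try solve_size.
- by rewrite addnC mulnC modnMDl modn_small.
step B => //; try solve_size.
- by rewrite addnC mulnC divnMDl // divn_small ?addn0.
have run_Rec := Rec_correct d X1 Y1 fundXY d_gt0 E n n_gt1 E_gt0 size_d size_A size_B.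
by apply: (computes_bind _ _ _ _ run_Rec); apply: computes_ret.
Qed.

Lemma bindigits_le n v : 0 < n -> v < 2 ^ n -> bindigits v <= n.
Proof.
move=> n_gt0 lt_v; rewrite /bindigits; case: (posnP v) => [-> | v_gt0].
  by rewrite trunc_log0.
rewrite -(@ltn_exp2l 2) //; apply: leq_ltn_trans lt_v.
exact: trunc_logP.
Qed.

Theorem theorem10 :
  exists c1 c2 : nat,
  forall d X1 Y1 K w : nat,
    2 <= d ->
    (forall s : nat, d <> s ^ 2) ->
    fundamental_solution d X1 Y1 ->
    X1 < K ->
    64 <= K ->
    w = (2 * K) ^ 4 ->
    exists (M : nat) (intermediates : seq nat),
      [/\ SC d K w = Some ((M, (X1, Y1)), intermediates),
          bindigits M <= 3 * w * (2 * K + 1) * K ^ 3,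
          3 * w * (2 * K + 1) * K ^ 3 <= c1 * K ^ 8
        & forall v : nat, v \in intermediates -> bindigits v <= c2 * K ^ 8].
Proof.
exists 144, 501 => d X1 Y1 K w d_ge2 _ fundXY lt_XK le_64K def_w.
have K_gt0 : 0 < K by apply: leq_trans le_64K.
have [M lt_M [intermediates run_SC size_all]] :=
  SC_correct d X1 Y1 K w (ltnW d_ge2) fundXY lt_XK le_64K def_w.
exists M, intermediates; split=> //.
- apply: bindigits_le lt_M.
  have w_gt0 : 0 < w by rewrite def_w expn_gt0 muln_gt0 K_gt0.
  by rewrite !muln_gt0 w_gt0 addn1 ?expn_gt0 K_gt0.
- rewrite def_w (_ : 144 * K ^ 8 = 3 * (2 * K) ^ 4 * (3 * K) * K ^ 3); last by ring.
  by rewrite leq_mul2r leq_mul2l (_ : 2 * K + 1 <= 3 * K) ?orbT //; lia.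
- (* The value 2 ^ (500 K ^ 8) itself has one digit more than its exponent. *)
  move=> v v_in; have K8_gt0 : 0 < K ^ 8 by rewrite expn_gt0 K_gt0.
  apply: bindigits_le; first by rewrite muln_gt0.
  apply: leq_ltn_trans (allP size_all v v_in) _.
  by rewrite ltn_exp2l // ltn_mul2r K8_gt0.
Qed.
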